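(* Let $k,\ell\in\mathbb{N}$ with $k<\ell$ and let $f\in\mathcal{H}$ satisfy $f(t)\ll t^k$ (with a representative defined and smooth on $[1,\infty)$). For $N\in\mathbb{N}$ let $P_{N,\ell}(y) = \sum_{j=0}^{\ell-1}\frac{y^j}{j!}f^{(j)}(N)$ be the length-$\ell$ Taylor polynomial of $f$ at $N$. Then there exists $0<\eta<1$ depending only on $\ell$ such that for every $H\in\mathbb{N}$, the formula \[ e_N(h) := \lfloor f(N+h)\rfloor - \lfloor P_{N,\ell}(h)\rfloor,\qquad 0\le h<H, \] defines at most $\exp(O(H^{\eta}))$ different functions $e_N\colon\{0,1,\dots,H-1\}\to\mathbb{Z}$ as $N$ ranges over $\mathbb{N}$. Moreover, for each $N$ at least one of the following holds: (A) $N = O(H^{(\ell+\eta)/(\ell-k)})$; (B) there are at most $O(H^{\eta})$ values of $h\in\{0,\dots,H-1\}$ with $e_N(h)\neq 0$; (C) there exists a partition of $\{0,\dots,H-1\}$ into $O(H^{\eta})$ arithmetic progressions with step $O(H^{\eta})$ on each of which $e_N$ is constant. Here all implicit constants in $O(\cdot)$ depend only on $k,\ell$ and $f$ (not on $H$ or $N$).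
   Context: $\mathcal{H}$ denotes the union of all Hardy fields (subfields of the ring of germs at $+\infty$ of real functions on half-lines, closed under differentiation). $f(t)\ll t^k$ means $|f(t)|\le Ct^k$ for some $C>0$ and all large $t$. *)

(* Defs.v *)
From HB Require Import structures.
From mathcomp Require Import all_boot all_order all_algebra.
From mathcomp Require Import all_classical all_reals all_analysis.
Set Implicit Arguments. Unset Strict Implicit. Unset Printing Implicit Defensive.
Import Order.TTheory GRing.Theory Num.Theory.
Local Open Scope ring_scope.
Local Open Scope classical_set_scope.

Definition eventually_ge (R : realType) (P : R -> Prop) : Prop :=
  exists a : R, forall x, a <= x -> P x.

Definition germ_eq (R : realType) (g h : R -> R) : Prop :=
  eventually_ge (fun x => g x = h x).

(* A Hardy field, represented as the set F of all representatives of its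
   germs (hence closed under germ equality): a field of germs at +oo whose
   elements are eventually_ge differentiable, closed under differentiation. *)
Definition hardy_field (R : realType) (F : set (R -> R)) : Prop :=
  (forall g h, F g -> germ_eq g h -> F h) /\
  F (fun _ => 0) /\ F (fun _ => 1) /\
  (forall g h, F g -> F h -> F (fun x => g x + h x)) /\
  (forall g h, F g -> F h -> F (fun x => g x * h x)) /\
  (forall g, F g -> F (fun x => - g x)) /\
  (forall g, F g -> ~ germ_eq g (fun _ => 0) ->
      exists2 h, F h & germ_eq (fun x => g x * h x) (fun _ => 1)) /\
  (forall g, F g ->
      eventually_ge (fun x => derivable g x 1) /\ F (derive1 g)).

Definition in_hardy (R : realType) (f : R -> R) : Prop :=
  exists2 F : set (R -> R), hardy_field F & F f.

Definition taylor_poly (R : realType) (f : R -> R) (l : nat) (N y : R) : R :=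
  \sum_(j < l) (y ^+ j / (j`!)%:R) * derive1n j f N.

Definition eN (R : realType) (f : R -> R) (l N h : nat) : int :=
  Num.floor (f (N%:R + h%:R)) - Num.floor (taylor_poly f l N%:R h%:R).

Definition in_ap (ap : nat * nat * nat) (x : nat) : Prop :=
  let: (a, s, n) := ap in exists2 i, (i < n)%N & x = (a + s * i)%N.

(* Main.v *)
(* In a Hardy field f(t) << t^k gives f^(l)(t) << t^(k-l), and f^(l) has
   eventually constant sign. Hence, when (A) fails, f(N+h) and P_N(h) differ by
   O(H^(-eta)), and e_N(h) <> 0 forces P_N(h) to be that close to an integer. Cut {0,...,H-1} into windows of length W = M^(l^2+1), where M is
   a small power of H, and each window into blocks of length M. Either every block
   of a window contains fewer than l points with e_N <> 0, or some block contains l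
   of them; then Lagrange interpolation at these l points writes P_N on the window
   as q/D + O(1) with q an integral polynomial and D <= M^(l^2). On a residue class
   modulo D both f(N+h) and P_N(h) are then bounded modulo an integer valued
   polynomial of degree < l, and, their l-th differences having constant sign,
   their floors change only O(l) times. In both cases the window splits into
   O(W/M) progressions on which e_N is constant, so that (C) always holds when (A)
   fails, and counting the partitions bounds the number of functions e_N. *)
Require Import Defs.
From HB Require Import structures.
From mathcomp Require Import all_boot all_order all_algebra.
From mathcomp Require Import all_classical all_reals all_analysis.
From mathcomp Require Import zify ring lra.
Set Implicit Arguments. Unset Strict Implicit. Unset Printing Implicit Defensive.
Import Order.TTheory GRing.Theory Num.Theory.
Local Open Scope ring_scope.

(** * Changes of value along a sequence *)

Definition changes (T : eqType) (u : nat -> T) (n : nat) : nat :=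
  count (fun m => u m != u m.+1) (iota 0 n).

Lemma changesS (T : eqType) (u : nat -> T) (n : nat) :
  changes u n.+1 = (changes u n + (u n != u n.+1))%N.
Proof. by rewrite /changes -[in iota 0 n.+1]addn1 iotaD count_cat /= addn0. Qed.

Lemma eq_changes (T : eqType) (u v : nat -> T) (n : nat) :
  (forall m, (m <= n)%N -> u m = v m) -> changes u n = changes v n.
Proof.
move=> uv; apply: eq_in_count => m; rewrite mem_iota => /andP[_ mn].
by rewrite !uv //; lia.
Qed.

(** The flag [d m] gives the only direction in which [b] may change at step [m]. Consecutive changes
    of [b] have opposite directions, so [d] must change between them. *)
Lemma changes_monotone_runs (b d : nat -> bool) (n : nat) :
  (forall m, d m -> b m -> b m.+1) ->
  (forall m, ~~ d m -> b m.+1 -> b m) ->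
  (changes b n.+1 <= changes d n + 1)%N.
Proof.
move=> up down.
(* Right after a change, [b n.+1] agrees with [d n]. The added term records that a further change is
   available without a new change of [d]. *)
suff: (changes b n.+1 + (b n.+1 != d n) <= changes d n + 1)%N by lia.
elim: n => [|n IH].
  rewrite changesS /changes /= add0n.
  move: (up 0%N) (down 0%N).
  by case: (b 0%N); case: (b 1%N); case: (d 0%N) => //= u1 u2;
    first [by have := u1 isT isT | by have := u2 isT isT].
move: IH; rewrite (changesS b n.+1) (changesS d n).
move: (up n.+1) (down n.+1).
case: (b n.+1); case: (d n); case: (d n.+1); case: (b n.+2) => //= u1 u2;
  first [by have := u1 isT isT | by have := u2 isT isT | lia].
Qed.

Lemma count_le_sum (T : Type) (s : seq T) (P : pred T) (J : nat)
    (Q : nat -> pred T) :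
  (forall x, P x -> exists2 j, (j < J)%N & Q j x) ->
  (count P s <= \sum_(j < J) count (Q j) s)%N.
Proof.
move=> PQ; elim: s => [|x s IH] //=.
rewrite big_split /=; apply: leq_add => //.
case Px: (P x) => //; have [j jJ Qx] := PQ _ Px.
by rewrite (bigD1 (Ordinal jJ)) //= Qx.
Qed.

(** * Partitions into arithmetic progressions *)

Lemma in_apE (a s n x : nat) : (0 < s)%N ->
  `[< in_ap (a, s, n) x >] =
  [&& (a <= x)%N, (s %| x - a)%N & ((x - a) %/ s < n)%N].
Proof.
move=> s0; apply/asboolP/idP => [[i lin ->]|/and3P[ax sx xn]].
  by rewrite leq_addr addKn dvdn_mulr //= mulKn.
by exists ((x - a) %/ s)%N => //; rewrite mulnC divnK // subnKC.
Qed.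

Lemma in_ap_cat (a s m n x : nat) : (0 < s)%N ->
  (`[< in_ap (a, s, m + n)%N x >] : nat) =
  (`[< in_ap (a, s, m) x >] + `[< in_ap (a + s * m, s, n) x >])%N.
Proof.
move=> s0; rewrite !in_apE //.
case: (leqP a x) => /= [ax|xa]; last first.
  by rewrite (_ : (a + s * m <= x)%N = false) //; lia.
have [y ->] : exists y, x = (a + y)%N by exists (x - a)%N; lia.
rewrite addKn leq_add2l subnDl.
case: (leqP (s * m) y) => [my|ym] /=.
  have [z ->] : exists z, y = (s * m + z)%N by exists (y - s * m)%N; lia.
  rewrite addKn dvdn_addr ?dvdn_mulr // mulnC divnMDl // ltn_add2l.
  by rewrite [(m + _ < m)%N]ltnNge leq_addr /= andbF add0n.
have ymd : (y %/ s < m)%N by rewrite ltn_divLR // mulnC.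
by rewrite ymd (ltn_addr n ymd) addn0.
Qed.

Lemma in_ap0 (a s x : nat) : `[< in_ap (a, s, 0%N) x >] = false.
Proof. by apply/asboolP => -[]. Qed.

Lemma in_ap_interval (a n x : nat) :
  `[< in_ap (a, 1, n)%N x >] = (a <= x < a + n)%N.
Proof. by rewrite in_apE // dvd1n divn1 /=; case: (leqP a x) => //= ax; lia. Qed.

(* [X] is the indicator function of the partitioned set, with values in [nat] so
   that disjoint unions become sums. *)
Definition ap_partition (e : nat -> int) (D : nat) (X : nat -> nat)
    (P : seq (nat * nat * nat)) : Prop :=
  (forall x, count (fun ap => `[< in_ap ap x >]) P = X x) /\
  (forall ap, ap \in P -> [/\ (0 < ap.1.2)%N, (ap.1.2 <= D)%N, (0 < ap.2)%N
    & forall x y, in_ap ap x -> in_ap ap y -> e x = e y]).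

Lemma ap_partition_cat e D X1 X2 X P1 P2 :
  (forall x, X x = X1 x + X2 x)%N ->
  ap_partition e D X1 P1 -> ap_partition e D X2 P2 ->
  ap_partition e D X (P1 ++ P2).
Proof.
move=> XE [c1 h1] [c2 h2]; split => [x|ap]; first by rewrite count_cat c1 c2 XE.
by rewrite mem_cat => /orP[/h1|/h2].
Qed.

Lemma eq_ap_partition e D X1 X2 P :
  X1 =1 X2 -> ap_partition e D X1 P -> ap_partition e D X2 P.
Proof. by move=> XE [c h]; split=> // x; rewrite c XE. Qed.

Lemma ap_partition_leq e D1 D2 X P :
  (D1 <= D2)%N -> ap_partition e D1 X P -> ap_partition e D2 X P.
Proof.
move=> D12 [c h]; split=> // ap /h[? h2 ? ?]; split=> //.
exact: leq_trans D12.
Qed.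

Lemma ap_partition_nil e D : ap_partition e D (fun=> 0%N) [::].
Proof. by []. Qed.

Lemma ap_partition_single e D a s n : (0 < s <= D)%N -> (0 < n)%N ->
  (forall i, (i < n)%N -> e (a + s * i)%N = e a) ->
  ap_partition e D (fun x => `[< in_ap (a, s, n) x >]) [:: (a, s, n)].
Proof.
move=> /andP[s0 sD] n0 h; split=> [x /=|ap]; first by rewrite addn0.
rewrite inE => /eqP ->; split=> //= x y [i lin ->] [j jn ->].
by rewrite !h.
Qed.

Lemma ap_partition_changes e D a s n : (0 < s <= D)%N ->
  exists2 P, ap_partition e D (fun x => `[< in_ap (a, s, n) x >]) P &
  (size P <= changes (fun m => e (a + s * m)%N) n.-1 + 1)%N.
Proof.
move=> /andP[s0 sD]; case: n => [|n].
  by exists [::] => //; apply: eq_ap_partition (ap_partition_nil _ _) => x; rewrite in_ap0.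
set u := (X in changes X _); rewrite -pred_Sn.
(* Here [t] is the start of the last constant run: [P] covers the runs already closed, one per
   change, and the open run is added at the end. *)
suff [P [t [tn ct hP sP]]] : exists P, exists t, [/\ (t <= n)%N,
    (forall m, (t <= m <= n)%N -> u m = u t),
    ap_partition e D (fun x => `[< in_ap (a, s, t) x >]) P
    & (size P <= changes u n)%N].
  exists (P ++ [:: (a + s * t, s, n.+1 - t)%N]); last first.
    by rewrite size_cat /=; lia.
  apply: ap_partition_cat hP _; last first.
    apply: ap_partition_single; rewrite ?s0 //; first by lia.
    by move=> i it; rewrite -addnA -mulnDr; apply: ct; lia.
  by move=> x; rewrite -in_ap_cat // subnKC //; lia.
elim: n => [|n [P [t [tn ct hP sP]]]].
  exists [::], 0%N; split=> //.
    by move=> m; rewrite leqn0 => /eqP ->.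
  by apply: eq_ap_partition (ap_partition_nil _ _) => x; rewrite in_ap0.
rewrite changesS; case: (eqVneq (u n) (u n.+1)) => [un|un] /=.
  exists P, t; split=> //; try lia.
  move=> m /andP[tm]; rewrite leq_eqVlt => /orP[/eqP ->|mn].
    by rewrite -un; apply: ct; lia.
  by apply: ct; lia.
exists (P ++ [:: (a + s * t, s, n.+1 - t)%N]), n.+1; split => //.
- by move=> m; rewrite -eqn_leq => /eqP <-.
- apply: ap_partition_cat hP _; last first.
    apply: ap_partition_single; rewrite ?s0 //; first by lia.
    by move=> i it; rewrite -addnA -mulnDr; apply: ct; lia.
  by move=> x; rewrite -in_ap_cat // subnKC //; lia.
by rewrite size_cat /=; lia.
Qed.

Lemma ap_partition_blocks e D M c q a n : (n <= M * q)%N ->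
  (forall a' n', (a <= a')%N -> (a' + n' <= a + n)%N -> (n' <= M)%N ->
    exists2 P, ap_partition e D (fun x => `[< in_ap (a', 1, n')%N x >]) P
      & (size P <= c)%N) ->
  exists2 P, ap_partition e D (fun x => `[< in_ap (a, 1, n)%N x >]) P
    & (size P <= c * q)%N.
Proof.
elim: q a n => [|q IH] a n nMq blk.
  have -> : n = 0%N by lia.
  by exists [::] => //; apply: eq_ap_partition (ap_partition_nil _ _) => x; rewrite in_ap0.
have [P1 h1 s1] := blk a (minn n M) (leqnn _) ltac:(lia) ltac:(lia).
have [P2 h2 s2] : exists2 P, ap_partition e D
    (fun x => `[< in_ap (a + 1 * minn n M, 1, n - minn n M)%N x >]) P & (size P <= c * q)%N.
  apply: IH; first by lia.
  by move=> a' n' ? ? ?; apply: blk => //; lia.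
exists (P1 ++ P2); last by rewrite size_cat mulnS leq_add.
apply: ap_partition_cat h1 h2 => x.
by rewrite -in_ap_cat // subnKC //; lia.
Qed.

Lemma ap_partition_residues e D c a n : (0 < D)%N ->
  (forall i t, (i < D)%N -> (forall m, (m < t)%N -> (i + D * m < n)%N) ->
    exists2 P, ap_partition e D (fun x => `[< in_ap (a + i, D, t)%N x >]) P
      & (size P <= c)%N) ->
  exists2 P, ap_partition e D (fun x => `[< in_ap (a, 1, n)%N x >]) P
    & (size P <= c * D)%N.
Proof.
move=> D0 res.
(* Induction on the number [j] of residue classes already covered. *)
suff h : forall j, (j <= D)%N -> exists2 P, ap_partition e D
    (fun x => ((a <= x < a + n) && ((x - a) %% D < j))%N) P & (size P <= c * j)%N.
  have [P hP sP] := h D (leqnn _); exists P => //.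
  by apply: eq_ap_partition hP => x; rewrite in_ap_interval ltn_pmod // andbT.
elim=> [|j IH] jD.
  by exists [::] => //; apply: eq_ap_partition (ap_partition_nil _ _) => x; rewrite ltn0 andbF.
have [P1 h1 s1] := IH (ltnW jD).
(* The number of terms of class [j], a quotient rounded up. It is 0 when [n <= j], thanks to the
   truncated subtraction. *)
set t := ((n - j + D.-1) %/ D)%N.
have tP m : (m < t)%N = (j + D * m < n)%N.
  rewrite /t; apply/idP/idP => h.
    have : (m.+1 * D <= n - j + D.-1)%N by rewrite -leq_divRL.
    by rewrite mulSn mulnC; lia.
  by rewrite leq_divRL // mulSn mulnC; lia.
have [|P2 h2 s2] := res j t jD; first by move=> m; rewrite tP.
exists (P1 ++ P2); last by rewrite size_cat mulnS addnC leq_add.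
apply: ap_partition_cat h1 h2 => x.
rewrite in_apE // tP.
case: (leqP a x) => /= [ax|xa]; last by rewrite (_ : (a + j <= x)%N = false) //; lia.
have [y ->] : exists y, x = (a + y)%N by exists (x - a)%N; lia.
rewrite addKn ltn_add2l leq_add2l subnDl.
have yE := divn_eq y D; have ymD := ltn_pmod y D0.
rewrite ltnS; case: (ltngtP (y %% D)%N j) => [lt|gt|eq]; rewrite ?andbT ?andbF ?add0n.
- rewrite andbA; suff -> : (j <= y)%N && (D %| y - j)%N = false by rewrite addn0.
  apply/negbTE/negP => /andP[jy /dvdnP[z zE]].
  have : (y %% D = j)%N.
    by rewrite (_ : y = z * D + j)%N ?modnMDl ?modn_small //; lia.
  lia.
- rewrite andbA; suff -> : (j <= y)%N && (D %| y - j)%N = false by [].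
  apply/negbTE/negP => /andP[jy /dvdnP[z zE]].
  have : (y %% D = j)%N.
    by rewrite (_ : y = z * D + j)%N ?modnMDl ?modn_small //; lia.
  lia.
have -> : (y - j = y %/ D * D)%N by rewrite {1}yE eq addnK.
rewrite dvdn_mull // mulnK // -eq leq_mod /=.
by rewrite addnC mulnC -yE.
Qed.

(** A change involves at least one value other than [c], and each such value is adjacent to at most
    two changes. The induction keeps one unit in reserve when the last value differs from [c]. *)
Lemma changes_sparse (T : eqType) (u : nat -> T) (c : T) (n : nat) :
  (changes u n <= 2 * count (fun m => u m != c) (iota 0 n.+1))%N.
Proof.
suff: (changes u n + (u n != c) <= 2 * count (fun m => u m != c) (iota 0 n.+1))%N by lia.
elim: n => [|n IH]; first by rewrite /changes /= addn0; lia.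
rewrite changesS -[in iota 0 n.+2]addn1 iotaD count_cat mulnDr.
move: IH; set A := count _ (iota 0 n.+1); set B := changes _ _.
rewrite /= add0n addn0; case: (eqVneq (u n) c) => [->|_]; case: (eqVneq (u n.+1) c) => [_|_] /=;
  try case: (u n == u n.+1) => /=; lia.
Qed.

(** The first listed progression containing [x] decides, so entries appended after a full partition
    have no effect. This allows words to be padded to a fixed length. *)
Definition ap_decode (s : seq (nat * nat * nat * int)) (x : nat) : int :=
  if [seq q <- s | `[< in_ap q.1 x >]] is q :: _ then q.2 else 0.

Lemma ap_partition_decode e D n P :
  ap_partition e D (fun x => (x < n)%N) P ->
  exists2 f : nat * nat * nat -> int, (forall ap, ap \in P -> f ap = e ap.1.1) &
  forall x s, (x < n)%N -> ap_decode ([seq (ap, f ap) | ap <- P] ++ s) x = e x.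
Proof.
move=> [cP hP]; exists (fun ap => e ap.1.1) => // x s xn.
rewrite /ap_decode filter_cat.
have := cP x; rewrite xn -size_filter filter_map /=.
have : {subset [seq ap <- P | `[< in_ap ap x >]] <= [predI mem P & fun ap => `[< in_ap ap x >]]}.
  by move=> ap; rewrite mem_filter inE andbC.
rewrite (eq_filter (a2 := fun ap => `[< in_ap ap x >])) //.
case: [seq ap <- P | _] => [//|ap t] sub _ /=.
have /andP[/= /hP[s0 _ n0 h] /asboolP hx] := sub ap (mem_head _ _).
apply: h => //; case: ap s0 n0 hx {sub} => -[a d] m /= ? ? _.
by exists 0%N => //; rewrite muln0 addn0.
Qed.

(** * Finite differences, level crossings and floors *)

Definition fdiff {R : zmodType} (u : nat -> R) (m : nat) : R := u m.+1 - u m.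

Lemma eq_iter_fdiff (R : zmodType) (u v : nat -> R) (l : nat) :
  u =1 v -> iter l fdiff u =1 iter l fdiff v.
Proof. by move=> uv; elim: l => //= l IH m; rewrite /fdiff !IH. Qed.

Lemma iter_fdiffB (R : comNzRingType) (u v : nat -> R) (l m : nat) :
  iter l fdiff (fun i => u i - v i) m = iter l fdiff u m - iter l fdiff v m.
Proof.
elim: l m => //= l IH m; rewrite /fdiff !IH -/fdiff; ring.
Qed.

Lemma poly_shift_sub (R : comNzRingType) (s : R) (p : {poly R}) :
  exists2 q : {poly R}, (size q <= (size p).-1)%N &
    forall x, q.[x] = p.[x + s] - p.[x].
Proof.
elim/poly_ind: p => [|p c [q sq hq]].
  by exists 0 => [|x]; rewrite ?size_poly0 // !horner0 subr0.
have [->|p0] := eqVneq p 0.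
  by exists 0 => [|x]; rewrite ?size_poly0 // mul0r add0r !hornerE subrr.
have sp : (0 < size p)%N by rewrite size_poly_gt0.
(* Product rule for differences: [p(x+s)(x+s) - p(x)x = (p(x+s) - p(x))x + s p(x+s)]. *)
exists (q * 'X + s *: (p \Po ('X + s%:P))).
  rewrite size_MXaddC (negbTE p0) /=.
  apply: leq_trans (size_polyD _ _) _; rewrite geq_max; apply/andP; split.
    have [->|q0] := eqVneq q 0; first by rewrite mul0r size_poly0.
    by rewrite size_mulX // -(prednK sp) ltnS.
  apply: leq_trans (size_scale_leq _ _) _.
  apply: leq_trans (size_comp_poly_leq _ _) _.
  by rewrite size_XaddC /= muln1 prednK.
move=> x; rewrite !hornerE horner_comp !hornerE hq; ring.
Qed.

Lemma iter_fdiff_poly (R : comNzRingType) (p : {poly R}) (l : nat) (b s : R) (m : nat) :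
  (size p <= l)%N -> iter l fdiff (fun i => p.[b + s * i%:R]) m = 0.
Proof.
elim: l p m => [|l IH] p m; first by rewrite leqn0 size_poly_eq0 => /eqP->; rewrite /= horner0.
move=> sp; have [q sq hq] := poly_shift_sub s p.
rewrite iterSr -[RHS](IH q m); last by lia.
apply: eq_iter_fdiff => i; rewrite /fdiff hq -addrA -addn1 natrD; congr (_.[_] - _); ring.
Qed.

Definition one_signed (R : numDomainType) (u : nat -> R) : Prop :=
  (forall m, 0 <= u m) \/ (forall m, u m <= 0).

(* A level is crossed at most once on each run of constant sign of the
   differences, so each summation adds at most one change. *)
Lemma changes_level (R : realDomainType) (l : nat) (u : nat -> R) (t : R) (n : nat) :
  one_signed (iter l.+1 fdiff u) -> (changes (fun m => t <= u m)%R n <= l.+1)%N.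
Proof.
elim: l u t n => [|l IH] u t [|n] // hu.
  have [d cd [up down]] : exists2 d : nat -> bool, changes d n = 0%N &
      (forall m, d m -> u m <= u m.+1) /\ (forall m, ~~ d m -> u m.+1 <= u m).
    case: hu => hu; [exists (fun=> true)|exists (fun=> false)].
    - by rewrite /changes (eq_count (a2 := pred0)) ?count_pred0 // => m /=; rewrite eqxx.
    - by split=> // m _; have := hu m; rewrite /= /fdiff subr_ge0.
    - by rewrite /changes (eq_count (a2 := pred0)) ?count_pred0 // => m /=; rewrite eqxx.
    - by split=> // m _; have := hu m; rewrite /= /fdiff subr_le0.
  have := @changes_monotone_runs (fun m => t <= u m)%R d n; rewrite cd; apply.
    by move=> m /up h1 h2; apply: le_trans h1.
  by move=> m /down h1 h2; apply: le_trans h1.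
have IH' := IH (fdiff u) 0 n; rewrite -iterSr in IH'.
apply: leq_trans (changes_monotone_runs _ (d := fun m => 0 <= fdiff u m) _ _) _.
- by move=> m; rewrite /fdiff subr_ge0 => h1 h2; apply: le_trans h1.
- by move=> m; rewrite /fdiff subr_ge0 -ltNge => /ltW h1 h2; apply: le_trans h1.
- by rewrite addn1 ltnS IH'.
Qed.

(** When the floor changes, [u] crosses the integer level equal to the larger of the two floors.
    Staying within 2 of [c] leaves at most six candidate levels. *)
Lemma changes_floor (R : archiRealDomainType) (u : nat -> R) (c : R) (k n : nat) :
  (forall m, (m <= n)%N -> `|u m - c| <= 2) ->
  (forall t : R, (changes (fun m => t <= u m)%R n <= k)%N) ->
  (changes (fun m => Num.floor (u m)) n <= 6 * k)%N.
Proof.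
move=> uc lev; set c0 := Num.floor c.
have flr m : (m <= n)%N -> c0 - 2 <= Num.floor (u m) <= c0 + 3.
  move=> /uc; rewrite ler_norml => /andP[h1 h2].
  have /andP[f1 f2] := floor_itv c; rewrite -/c0 in f1 f2.
  have /andP[g1 g2] := floor_itv (u m).
  have a1 : (c0 - 2)%:~R < (Num.floor (u m) + 1)%:~R :> R.
    by apply: le_lt_trans g2; rewrite intrB; lra.
  have a2 : (Num.floor (u m))%:~R < (c0 + 3 + 1)%:~R :> R.
    by apply: le_lt_trans g1 _; move: f2; rewrite !intrD; lra.
  by move: a1 a2; rewrite !ltr_int; lia.
rewrite /changes.
set P := fun m => Num.floor (u m) != Num.floor (u m.+1).
pose Q j m := ((c0 - 2 + Posz j)%:~R <= u m) != ((c0 - 2 + Posz j)%:~R <= u m.+1).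
have -> : count P (iota 0 n) = count (fun m => (m < n)%N && P m) (iota 0 n).
  by apply: eq_in_count => m; rewrite mem_iota /= add0n => ->.
apply: leq_trans (count_le_sum (J := 6) (Q := Q) _ _) _.
  move=> m /andP[mn]; rewrite /P neq_lt => Pm.
  have /andP[a1 a2] := flr m (ltnW mn); have /andP[b1 b2] := flr m.+1 mn.
  case/orP: Pm => lt.
    exists `|(Num.floor (u m.+1) - (c0 - 2))%R|%N; first by lia.
    by rewrite /Q -!floor_ge_int; apply/negP => /eqP; lia.
  exists `|(Num.floor (u m) - (c0 - 2))%R|%N; first by lia.
  by rewrite /Q -!floor_ge_int; apply/negP => /eqP; lia.
have -> : (6 * k = \sum_(j < 6) k)%N by rewrite sum_nat_const card_ord.
by apply: leq_sum => j _; apply: lev.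
Qed.

Lemma changes_sub (V : zmodType) (u v : nat -> V) (n : nat) :
  (changes (fun m => u m - v m)%R n <= changes u n + changes v n)%N.
Proof.
elim: n => // n IH; rewrite !changesS.
suff: (((u n - v n)%R != (u n.+1 - v n.+1)%R) <= (u n != u n.+1) + (v n != v n.+1))%N by lia.
by have [->|_] := eqVneq (u n); have [->|_] := eqVneq (v n); rewrite ?eqxx //=; case: eqVneq.
Qed.

(** * Integral polynomials and Lagrange interpolation *)

Lemma map_poly_intr_int (R : nzRingType) (q : {poly int}) (x : int) :
  (map_poly intr q : {poly R}).[x%:~R] = (q.[x])%:~R.
Proof. exact: horner_map. Qed.

Lemma dvdz_horner_sub (q : {poly int}) (x y : int) : (x - y %| q.[x] - q.[y])%Z.
Proof.
elim/poly_ind: q => [|q c IH]; first by rewrite !horner0 subrr dvdz0.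
rewrite !hornerE.
have -> : q.[x] * x + c - (q.[y] * y + c) = (q.[x] - q.[y]) * x + q.[y] * (x - y) by ring.
by apply: rpredD; [exact: dvdz_mulr | exact: dvdz_mull].
Qed.

Lemma leq_prod_exp (T : eqType) (s : seq T) (F : T -> nat) (M : nat) :
  (forall x, x \in s -> (F x <= M)%N) -> (\prod_(x <- s) F x <= M ^ size s)%N.
Proof.
elim: s => [|a s IH] h; first by rewrite big_nil.
rewrite big_cons /= expnS leq_mul //; first by apply: h; rewrite mem_head.
by apply: IH => x xs; apply: h; rewrite inE xs orbT.
Qed.

Lemma ler_norm_prod_exp (R : numDomainType) (T : eqType) (s : seq T) (F : T -> R) (W : R) :
  (forall x, x \in s -> `|F x| <= W) -> `|\prod_(x <- s) F x| <= W ^+ size s.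
Proof.
elim: s => [|a s IH] h; first by rewrite big_nil normr1.
rewrite big_cons /= exprS normrM ler_pM //; first by apply: h; rewrite mem_head.
by apply: IH => x xs; apply: h; rewrite inE xs orbT.
Qed.

Lemma ler_norm_sum_seq (R : numDomainType) (T : eqType) (s : seq T) (F : T -> R) (W : R) :
  (forall x, x \in s -> `|F x| <= W) -> `|\sum_(x <- s) F x| <= (size s)%:R * W.
Proof.
elim: s => [|a s IH] h; first by rewrite big_nil normr0 mul0r.
rewrite big_cons /= -add1n natrD mulrDl mul1r (le_trans (ler_normD _ _)) // lerD //.
  by apply: h; rewrite mem_head.
by apply: IH => x xs; apply: h; rewrite inE xs orbT.
Qed.

(* [D] is the common denominator of the Lagrange polynomials of [s]; it is small
   because the points of [s] are close to each other. *)
Lemma interpolation (R : archiRealFieldType) (s : seq nat) (c M : nat) (p : {poly R}) (d W : R) :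
  uniq s -> (forall x, x \in s -> (c <= x < c + M)%N) -> (size p <= size s)%N ->
  (forall x, x \in s -> exists n : int, `|p.[x%:R] - n%:~R| <= d) ->
  exists D : nat, exists2 q : {poly int}, [/\ (0 < D)%N, (D <= M ^ (size s * size s))%N
      & (size q <= size s)%N] &
    forall y : R, (forall x, x \in s -> `|y - x%:R| <= W) ->
      `|p.[y] - (map_poly intr q).[y] / D%:R| <= (size s)%:R * (d * W ^+ (size s).-1).
Proof.
move=> us sM sp near; set l := size s in sp *.
have /choice [n hn] : forall x : nat, exists n : int, x \in s -> `|p.[x%:R] - n%:~R| <= d.
  by move=> x; case xs: (x \in s); [have [n ?] := near x xs; exists n|exists 0].
(* Lagrange basis without its denominators: [L x] vanishes on the other points of [s] and equals
   [Dx x] at [x]. *)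
pose L x : {poly int} := \prod_(z <- rem x s) ('X - (Posz z)%:P).
pose Dx x : int := (L x).[Posz x].
pose D := (\prod_(x <- s) `|Dx x|)%N.
have DxE x : Dx x = \prod_(z <- rem x s) (Posz x - Posz z).
  by rewrite /Dx /L horner_prod; apply: eq_bigr => z _; rewrite !hornerE.
have Dx0 x : Dx x != 0.
  rewrite DxE prodf_seq_neq0; apply/allP => z; rewrite mem_rem_uniq // inE => /andP[zx _] /=.
  by rewrite subr_eq0; apply: contra zx => /eqP[->].
have srem x : x \in s -> size (rem x s) = l.-1 by move=> xs; rewrite size_rem.
have DxM x : x \in s -> (`|Dx x| <= M ^ l)%N.
  move=> xs; have M0 : (0 < M)%N by have := sM x xs; lia.
  apply: (@leq_trans (M ^ l.-1)); last by rewrite leq_pexp2l // leq_pred.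
  rewrite DxE -(srem x xs) (big_morph absz abszM absz1).
  apply: leq_prod_exp => z /mem_rem zs; have := sM x xs; have := sM z zs; lia.
have D0 : (0 < D)%N.
  by rewrite /D; apply: prodn_gt0 => x; rewrite absz_gt0.
have DdvdD x : x \in s -> (Dx x %| Posz D)%Z.
  by move=> xs; rewrite dvdzE /D (big_rem x xs) /= dvdn_mulr.
pose cx x := (Posz D %/ Dx x)%Z.
have cxE x : x \in s -> (cx x)%:~R / D%:R = (Dx x)%:~R^-1 :> R.
  move=> xs; have := divzK (DdvdD x xs); rewrite -/(cx x) => /(congr1 (fun z : int => z%:~R : R)).
  have a : (Dx x)%:~R != 0 :> R by rewrite intr_eq0.
  have b : D%:R != 0 :> R by rewrite pnatr_eq0 -lt0n.
  rewrite intrM -pmulrn => e; apply: (mulIf a); rewrite mulVf // mulrAC e divff //.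
(* [q / D] interpolates the nearby integers [n x]; the factor [cx x] is [D / Dx x], an integer. *)
pose q := \sum_(x <- s) (n x * cx x) *: L x.
have szL x : x \in s -> (size (L x) <= l)%N.
  move=> xs; rewrite /L size_prod_XsubC srem // prednK // /l.
  by case: (s) xs.
exists D, q; first split => //.
- apply: (@leq_trans ((M ^ l) ^ l)); first exact: leq_prod_exp.
  by rewrite expnM.
- rewrite /q big_seq; apply: (big_ind (fun r : {poly int} => (size r <= l)%N)).
  + by rewrite size_poly0.
  + by move=> a b sa sb; apply: leq_trans (size_polyD _ _) _; rewrite geq_max sa.
  + by move=> x xs; apply: leq_trans (size_scale_leq _ _) (szL x xs).
move=> y yW.
pose LR x : {poly R} := map_poly intr (L x).
have LRE x (z : R) : (LR x).[z] = \prod_(w <- rem x s) (z - w%:R).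
  rewrite /LR /L rmorph_prod horner_prod; apply: eq_bigr => w _ /=.
  by rewrite rmorphB /= map_polyX map_polyC /= !hornerE.
have LRx x : (LR x).[x%:R] = (Dx x)%:~R.
  by rewrite /LR (_ : x%:R = (Posz x)%:~R) // map_poly_intr_int.
have LRz x z : x \in s -> z \in s -> z != x -> (LR x).[z%:R] = 0.
  move=> xs zs zx; rewrite LRE (big_rem z) /=; last by rewrite mem_rem_uniq // inE zx.
  by rewrite subrr mul0r.
(* Both sides have size at most [l] and agree at [l] points, so a nonzero difference would have too
   many roots. *)
have pE : p = \sum_(x <- s) (p.[x%:R] / (Dx x)%:~R) *: LR x.
  apply/eqP; rewrite -subr_eq0; apply/negPn/negP => r0.
  have := max_poly_roots (rs := [seq x%:R | x <- s]) r0.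
  rewrite size_map map_inj_uniq; last by move=> a b /eqP; rewrite eqr_nat => /eqP.
  rewrite us -/l => h.
  have sr : (size (p - \sum_(x <- s) (p.[x%:R] / (Dx x)%:~R) *: LR x)%R <= l)%N.
    apply: leq_trans (size_polyD _ _) _; rewrite geq_max sp /= size_polyN.
    rewrite big_seq; apply: (big_ind (fun r : {poly R} => (size r <= l)%N)).
    + by rewrite size_poly0.
    + by move=> a b sa sb; apply: leq_trans (size_polyD _ _) _; rewrite geq_max sa.
    + move=> x xs; apply: leq_trans (size_scale_leq _ _) _.
      by apply: leq_trans (size_poly _ _) (szL x xs).
  have : (l < l)%N; last by rewrite ltnn.
  apply: leq_trans sr; apply: h => //; apply/allP => _ /mapP[z zs ->].
  rewrite /root hornerD hornerN horner_sum (bigD1_seq z) //= hornerZ LRx divfK ?intr_eq0 //.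
  rewrite big_seq_cond big1 ?addr0 ?subrr // => x /andP[xs xz].
  by rewrite hornerZ LRz ?mulr0 // eq_sym.
rewrite {1}pE horner_sum /q rmorph_sum horner_sum mulr_suml -sumrB.
apply: ler_norm_sum_seq => x xs.
rewrite hornerZ /= map_polyZ /= hornerZ -/(LR x) intrM.
have -> : p.[x%:R] / (Dx x)%:~R * (LR x).[y] - (n x)%:~R * (cx x)%:~R * (LR x).[y] / D%:R
   = (p.[x%:R] - (n x)%:~R) * ((Dx x)%:~R^-1 * (LR x).[y]).
  by rewrite -cxE //; ring.
rewrite normrM ler_pM // ?hn // normrM -[leRHS]mul1r ler_pM //; last first.
  by rewrite LRE -(srem x xs); apply: ler_norm_prod_exp => z /mem_rem /yW.
(* A nonzero integer has absolute value at least 1, so dividing by [Dx x] does not enlarge the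
   error. *)
rewrite normfV -intr_norm invf_le1 ?ltr0z ?ler1z; have := Dx0 x; lia.
Qed.

(** * Successive derivatives, their finite differences and Taylor polynomials *)

Definition derivative_tower (R : realType) (G : nat -> R -> R) (a : R) : Prop :=
  forall (j : nat) (x : R), a <= x -> is_derive x (1 : R) (G j) (G j.+1 x).

Lemma derive1n_tower (R : realType) (f : R -> R) (a : R) :
  (forall (j : nat) (x : R), a <= x -> derivable (derive1n j f) x 1) ->
  derivative_tower (fun j => derive1n j f) a.
Proof.
move=> df j x ax; rewrite derive1nS derive1E.
exact: derivableP (df j x ax).
Qed.

Lemma MVT_is_derive (R : realType) (f df : R -> R) (x y : R) : x <= y ->
  (forall z, x <= z <= y -> is_derive z (1 : R) f (df z)) ->
  exists2 c, x <= c <= y & f y - f x = df c * (y - x).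
Proof.
move=> xy fd.
have [||c] := @MVT_segment R f df x y xy.
- by move=> z; rewrite in_itv /= => /andP[/ltW ? /ltW ?]; apply: fd; apply/andP.
- apply: derivable_within_continuous => z; rewrite in_itv /= => /fd h.
  exact: (@ex_derive _ _ _ _ _ _ _ h).
by rewrite in_itv /= => hc ->; exists c.
Qed.

Lemma tower_shift (R : realType) (G : nat -> R -> R) (a : R) :
  derivative_tower G a -> derivative_tower (fun j => G j.+1) a.
Proof. by move=> tG j x /(tG j.+1). Qed.

Lemma is_derive_translate (R : realType) (f : R -> R) (s x d : R) :
  is_derive (x + s) (1 : R) f d -> is_derive x (1 : R) (fun y => f (y + s)) d.
Proof.
move=> fd.
have h : is_derive x (1 : R) (fun y : R => y + s) (1 + 0) by apply: is_deriveD.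
have := @is_derive1_comp R f (fun y : R => y + s) x d (1 + 0) fd h.
by rewrite addr0 mulr1.
Qed.

(** The inductions on the order replace the base function. Towers, being families indexed by the
    order, are stable under this differencing, under shifts and under negation. *)
Lemma tower_diff (R : realType) (G : nat -> R -> R) (a s : R) : 0 <= s ->
  derivative_tower G a -> derivative_tower (fun j x => G j (x + s) - G j x) a.
Proof.
move=> s0 tG j x ax; apply: is_deriveB; last exact: tG.
by apply: is_derive_translate; apply: tG; lra.
Qed.

(** One difference turns [G] into the tower of [G j (x + s) - G j x]; by the mean value theorem its
    [l]-th member inherits the sign of [G l.+1]. *)
Lemma iter_fdiff_tower_ge0 (R : realType) (l : nat) (G : nat -> R -> R) (a b s : R) (m : nat) :
  derivative_tower G a -> a <= b -> 0 <= s -> (forall x, a <= x -> 0 <= G l x) ->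
  0 <= iter l fdiff (fun i => G 0%N (b + s * i%:R)) m.
Proof.
move=> tG ab s0; elim: l G tG => [|l IH] G tG hG.
  by apply: hG; have : 0 <= s * m%:R; [exact: mulr_ge0|lra].
have := IH _ (tower_diff s0 tG); rewrite iterSr => h.
rewrite (@eq_iter_fdiff _ _ (fun i => G 0%N (b + s * i%:R + s) - G 0%N (b + s * i%:R))).
  apply: h => x ax; have [z /andP[xz _] ->] := @MVT_is_derive _ (G l) (G l.+1) x (x + s)
      ltac:(lra) (fun z hz => tG l z ltac:(lra)).
  by rewrite mulr_ge0 //; [apply: hG; lra|lra].
by move=> i; rewrite /fdiff -addn1 natrD; congr (G _ _ - _); ring.
Qed.

Lemma tower_opp (R : realType) (G : nat -> R -> R) (a : R) :
  derivative_tower G a -> derivative_tower (fun j x => - G j x) a.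
Proof. by move=> tG j x ax; apply: is_deriveN; apply: tG. Qed.

Lemma iter_fdiff_tower (R : realType) (l : nat) (G : nat -> R -> R) (a b s : R) :
  derivative_tower G a -> a <= b -> 0 <= s ->
  (forall x, a <= x -> 0 <= G l x) \/ (forall x, a <= x -> G l x <= 0) ->
  one_signed (iter l fdiff (fun i => G 0%N (b + s * i%:R))).
Proof.
move=> tG ab s0 [hG|hG]; [left|right] => m; first exact: iter_fdiff_tower_ge0 tG ab s0 hG.
have : 0 <= iter l fdiff (fun i => - G 0%N (b + s * i%:R)) m.
  apply: (@iter_fdiff_tower_ge0 _ l (fun j x => - G j x) a) => //.
    exact: tower_opp.
  by move=> x /hG; rewrite oppr_ge0.
rewrite (@eq_iter_fdiff _ _ (fun i => (0 : {poly R}).[b + s * i%:R] - G 0%N (b + s * i%:R))).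
  by rewrite iter_fdiffB iter_fdiff_poly ?size_poly0 // sub0r oppr_ge0.
by move=> i; rewrite horner0 sub0r.
Qed.

Definition taylor (R : realType) (G : nat -> R -> R) (l : nat) (a : R) : {poly R} :=
  \poly_(j < l) (G j a / (j`!)%:R).

Lemma deriv_taylor (R : realType) (G : nat -> R -> R) (l : nat) (a : R) :
  (taylor G l.+1 a)^`() = taylor (fun j => G j.+1) l a.
Proof.
apply/polyP => j; rewrite coef_deriv !coef_poly ltnS; case: ltnP => // _; last by rewrite mul0rn.
by rewrite factS natrM invfM -[LHS]mulr_natr [_^-1 * _]mulrC mulrA divfK // pnatr_eq0.
Qed.

(** The derivative of the error of order [l.+1] is the error of order [l] for [G 1], so the mean
    value theorem gains one factor [y]. The factorial saving is given up. *)
Lemma taylor_bound (R : realType) (l : nat) (G : nat -> R -> R) (a B y : R) :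
  derivative_tower G a -> (forall x, a <= x -> `|G l x| <= B) -> 0 <= y ->
  `|G 0%N (a + y) - (taylor G l a).[y]| <= B * y ^+ l.
Proof.
elim: l G y => [|l IH] G y tG hG y0.
  by rewrite /taylor poly_def big_ord0 horner0 subr0 expr0 mulr1 hG //; lra.
pose g y := G 0%N (y + a) - (taylor G l.+1 a).[y].
have g0 : g 0 = 0.
  by rewrite /g add0r horner_coef0 coef_poly /= fact0 divr1 subrr.
have dg z : 0 <= z <= y -> is_derive z (1 : R) g (G 1%N (z + a) - (taylor (fun j => G j.+1) l a).[z]).
  move=> zy; apply: is_deriveB.
    by apply: is_derive_translate; apply: tG; lra.
  rewrite -deriv_taylor; exact: is_derive_poly.
have [c hc] := MVT_is_derive y0 dg.
rewrite g0 !subr0 /g [y + a]addrC [c + a]addrC => ->.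
rewrite normrM (ger0_norm y0) exprSr mulrA ler_wpM2r //.
apply: le_trans (IH (fun j => G j.+1) c _ _ _) _.
- exact: tower_shift.
- by [].
- lra.
have B0 : 0 <= B by apply: le_trans (hG a (lexx _)).
by rewrite ler_wpM2l // lerXn2r ?nnegrE //; lra.
Qed.

(** * Hardy fields: constant sign and decay of derivatives *)

Lemma hardy_one_signed (R : realType) (F : set (R -> R)) (g : R -> R) :
  hardy_field F -> F g ->
  exists a : R, (forall x, a <= x -> 0 <= g x) \/ (forall x, a <= x -> g x <= 0).
Proof.
move=> [_ [_ [_ [_ [_ [_ [inv der]]]]]]] Fg.
have [[a ha]|nz] := pselect (germ_eq g (fun=> 0)).
  by exists a; left => x /ha ->.
have [h Fh [a ha]] := inv g Fg nz.
have [[b hb] _] := der g Fg.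
pose c := Num.max a b.
(* A nonzero germ is invertible, hence without zeros past [c]; being continuous there, [g] keeps its
   sign by the intermediate value theorem. *)
have gn0 x : c <= x -> g x != 0.
  rewrite ge_max => /andP[/ha e _]; apply/eqP => g0.
  by move: e; rewrite g0 mul0r => /eqP; rewrite eq_sym oner_eq0.
have ivt x y : c <= x -> x <= y -> Num.min (g x) (g y) <= 0 <= Num.max (g x) (g y) -> False.
  move=> cx xy h0; have [|z] := @IVT R g x y 0 xy _ h0.
    apply: derivable_within_continuous => z; rewrite in_itv /= => /andP[xz _].
    by apply: hb; move: cx; rewrite ge_max => /andP[]; lra.
  by rewrite in_itv /= => /andP[xz _] gz; have := gn0 z (le_trans cx xz); rewrite gz eqxx.
exists c; have [gc|gc] := leP 0 (g c); [left|right] => x cx; rewrite leNgt; apply/negP => gx.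
  by apply: (ivt c x) => //; rewrite ge_min le_max gc (ltW gx) orbT.
by apply: (ivt c x) => //; rewrite ge_min le_max (ltW gc) (ltW gx) orbT.
Qed.

Lemma hardy_derive1n (R : realType) (F : set (R -> R)) (f : R -> R) (j : nat) :
  hardy_field F -> F f -> F (derive1n j f).
Proof.
move=> hF Ff; elim: j => // j IH; rewrite derive1nS.
by have [_ [_ [_ [_ [_ [_ [_ der]]]]]]] := hF; have [] := der _ IH.
Qed.

(* If [g'] is monotone, the mean value theorem on [[t/2, t]] and on [[t, 2t]]
   bounds [t * g' t] on both sides by values of [g]. *)
Lemma derivative_decay (R : realType) (G : nat -> R -> R) (a : R) (m k : nat) (C : R) :
  derivative_tower G a -> 1 <= a ->
  (forall x, a <= x -> 0 <= G 2%N x) \/ (forall x, a <= x -> G 2%N x <= 0) ->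
  (forall x, a <= x -> `|G 0%N x| * x ^+ m <= C * x ^+ k) ->
  forall t, 2 * a <= t ->
    `|G 1%N t| * t ^+ m.+1 <= C * (2 ^+ k + 3 + 2 * 2 ^+ m) * t ^+ k.
Proof.
move=> tG a1 sgn hC t at2.
have [u [hu1 hu2]] : exists u, t = 2 * u /\ a <= u by exists (t / 2); split; lra.
have [x1 hx1 e1] := @MVT_is_derive _ (G 0%N) (G 1%N) u t ltac:(lra) (fun z hz => tG 0%N z ltac:(lra)).
have [x2 hx2 e2] := @MVT_is_derive _ (G 0%N) (G 1%N) t (2 * t) ltac:(lra) (fun z hz => tG 0%N z ltac:(lra)).
have mono x y : a <= x -> x <= y -> exists2 c, a <= c & G 1%N y - G 1%N x = G 2%N c * (y - x).
  move=> ax xy; have [c hc e] := @MVT_is_derive _ (G 1%N) (G 2%N) x y xy (fun z hz => tG 1%N z ltac:(lra)).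
  by exists c => //; lra.
have [c1 ac1 d1] := mono x1 t ltac:(lra) ltac:(lra).
have [c2 ac2 d2] := mono t x2 ltac:(lra) ltac:(lra).
have key : `|G 1%N t| * t <= `|G 0%N (2 * t)| + 3 * `|G 0%N t| + 2 * `|G 0%N u|.
  have t0 : 0 <= t by lra.
  have u0 : 0 <= u by lra.
  have tu : t - u = u by lra.
  have t2 : 2 * t - t = t by lra.
  have ptu : G 1%N t * t = 2 * (G 1%N t * u) by rewrite [X in _ * X = _]hu1; ring.
  rewrite tu in e1; rewrite t2 in e2.
  rewrite -[X in _ * X <= _](ger0_norm t0) -normrM.
  have nB1 := ler_norm (G 0%N (2 * t)); have nB2 := ler_norm (- G 0%N (2 * t)).
  have nA1 := ler_norm (G 0%N t); have nA2 := ler_norm (- G 0%N t).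
  have nE1 := ler_norm (G 0%N u); have nE2 := ler_norm (- G 0%N u).
  rewrite !normrN in nB2 nA2 nE2.
  rewrite ler_norml.
  case: sgn => sgn.
  - have p1 : G 1%N x1 * u <= G 1%N t * u.
      by rewrite ler_wpM2r // -subr_ge0 d1 mulr_ge0 ?sgn //; lra.
    have p2 : G 1%N t * t <= G 1%N x2 * t.
      by rewrite ler_wpM2r // -subr_ge0 d2 mulr_ge0 ?sgn //; lra.
    by apply/andP; split; lra.
  - have p1 : G 1%N t * u <= G 1%N x1 * u.
      by rewrite ler_wpM2r // -subr_le0 d1 mulr_le0_ge0 ?sgn //; lra.
    have p2 : G 1%N x2 * t <= G 1%N t * t.
      by rewrite ler_wpM2r // -subr_le0 d2 mulr_le0_ge0 ?sgn //; lra.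
    by apply/andP; split; lra.
have u0 : 0 <= u by lra.
have t0 : 0 <= t by lra.
have ut : u <= t by lra.
have b1 : `|G 0%N (2 * t)| * t ^+ m <= C * 2 ^+ k * t ^+ k.
  rewrite -mulrA -exprMn; apply: le_trans (hC (2 * t) ltac:(lra)).
  by rewrite ler_wpM2l // lerXn2r ?nnegrE //; lra.
have b2 : `|G 0%N t| * t ^+ m <= C * t ^+ k by apply: hC; lra.
have C0 : 0 <= C.
  have := hC a (lexx _); have : 0 < a ^+ k by apply: exprn_gt0; lra.
  move=> ak; have : 0 <= `|G 0%N a| * a ^+ m by rewrite mulr_ge0 // exprn_ge0 //; lra.
  by move=> h1 h2; rewrite -(pmulr_lge0 _ ak); apply: le_trans h2.
(* The hypothesis at [u] controls [u ^+ m] only, whence the factor [2 ^+ m]. *)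
have b3 : `|G 0%N u| * t ^+ m <= C * 2 ^+ m * t ^+ k.
  rewrite hu1 exprMn mulrCA [C * _]mulrC -!mulrA -hu1 ler_wpM2l ?exprn_ge0 //.
  apply: le_trans (hC u hu2) _; rewrite ler_wpM2l //.
  by rewrite lerXn2r ?nnegrE //; lra.
have tm : 0 <= t ^+ m by apply: exprn_ge0.
rewrite exprS mulrA; apply: le_trans (ler_wpM2r tm key) _.
have -> : C * (2 ^+ k + 3 + 2 * 2 ^+ m) * t ^+ k =
    C * 2 ^+ k * t ^+ k + 3 * (C * t ^+ k) + 2 * (C * 2 ^+ m * t ^+ k) by ring.
have -> : (`|G 0%N (2 * t)| + 3 * `|G 0%N t| + 2 * `|G 0%N u|) * t ^+ m =
    `|G 0%N (2 * t)| * t ^+ m + 3 * (`|G 0%N t| * t ^+ m) + 2 * (`|G 0%N u| * t ^+ m) by ring.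
by apply: lerD; [apply: lerD => //|]; rewrite ler_pM2l ?ltr0n.
Qed.

Lemma hardy_derivative_decay (R : realType) (f : R -> R) (k l : nat) :
  in_hardy f ->
  (forall (j : nat) (x : R), 1 <= x -> derivable (derive1n j f) x 1) ->
  (exists2 C : R, 0 < C & eventually_ge (fun t : R => `|f t| <= C * t ^+ k)) ->
  exists C a : R, [/\ 1 <= a, forall t, a <= t -> `|derive1n l f t| * t ^+ l <= C * t ^+ k
    & (forall t, a <= t -> 0 <= derive1n l f t) \/ (forall t, a <= t -> derive1n l f t <= 0)].
Proof.
move=> [F hF Ff] sm [C0 C00 [a0 h0]].
have tG := derive1n_tower sm.
have sgn j : exists2 a : R, 1 <= a & (forall t, a <= t -> 0 <= derive1n j f t) \/
    (forall t, a <= t -> derive1n j f t <= 0).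
  have [a ha] := hardy_one_signed hF (hardy_derive1n j hF Ff).
  exists (Num.max 1 a); first by rewrite le_max lexx.
  by case: ha => ha; [left|right] => t; rewrite ge_max => /andP[_]; exact: ha.
suff [C [a [a1 h]]] : exists C a, 1 <= a /\
    forall t, a <= t -> `|derive1n l f t| * t ^+ l <= C * t ^+ k.
  have [b b1 hb] := sgn l.
  exists C, (Num.max a b); split; first by rewrite le_max a1.
    by move=> t; rewrite ge_max => /andP[/h].
  by case: hb => hb; [left|right] => t; rewrite ge_max => /andP[_]; exact: hb.
elim: l => [|l [C [a [a1 h]]]].
  exists C0, (Num.max 1 a0); split; first by rewrite le_max lexx.
  by move=> t; rewrite ge_max expr0 mulr1 => /andP[_ /h0].
have [b b1 hb] := sgn l.+2.
pose c := Num.max a b.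
have c1 : 1 <= c by rewrite le_max a1.
exists (C * (2 ^+ k + 3 + 2 * 2 ^+ l)), (2 * c); split; first by lra.
(* The tower starts at order [l], so the sign required is that of the derivative of order
   [l + 2]. *)
apply: (@derivative_decay _ (fun j => derive1n (j + l) f)).
- by move=> j x cx; apply: tG; lra.
- exact: c1.
- by case: hb => hb; [left|right] => t; rewrite ge_max => /andP[_]; exact: hb.
- by move=> t; rewrite ge_max => /andP[/h].
Qed.

(** * Differences of floors of a function and a nearby polynomial *)

Lemma floor_neq_near_int (R : archiRealFieldType) (x y d : R) :
  `|x - y| <= d -> Num.floor x != Num.floor y -> exists n : int, `|y - n%:~R| <= d.
Proof.
move=> xyd; rewrite neq_lt.
(* The larger of the two floors is an integer lying between [x] and [y]. *)
have /andP[x1 x2] := floor_itv x; have /andP[y1 y2] := floor_itv y.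
move: xyd; rewrite ler_norml => /andP[h1 h2] /orP[lt|lt].
  exists (Num.floor y).
  have : (Num.floor x + 1)%:~R <= (Num.floor y)%:~R :> R by rewrite ler_int; lia.
  by move=> h; rewrite ler_norml; apply/andP; split; lra.
exists (Num.floor x).
have : (Num.floor y + 1)%:~R <= (Num.floor x)%:~R :> R by rewrite ler_int; lia.
by move=> h; rewrite ler_norml; apply/andP; split; lra.
Qed.

(** Abstract form of [eN]: [F] stands for [f] translated by [N], and [p] for its Taylor polynomial
    at [N]. *)
Definition floor_diff (R : archiRealFieldType) (F : nat -> R) (p : {poly R}) (x : nat) : int :=
  Num.floor (F x) - Num.floor p.[x%:R].

(* On a residue class modulo [D], [F] and [p] both differ by the same integer
   valued polynomial from functions staying within distance 2 of a constant. *)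
Lemma floor_diff_residues (R : archiRealFieldType) (l : nat) (F : nat -> R) (p : {poly R})
    (D a n : nat) (q : {poly int}) :
  (0 < l)%N -> (size p <= l)%N -> (size q <= l)%N -> (0 < D)%N ->
  (forall b s, one_signed (iter l fdiff (fun m => F (b + s * m)%N))) ->
  (forall x, (a <= x < a + n)%N -> `|F x - p.[x%:R]| <= 1) ->
  (forall x, (a <= x < a + n)%N -> `|p.[x%:R] - (map_poly intr q).[x%:R] / D%:R| <= 1) ->
  exists2 P, ap_partition (floor_diff F p) D (fun x => `[< in_ap (a, 1, n)%N x >]) P
    & (size P <= (12 * l + 1) * D)%N.
Proof.
case: l => // l _ sp sq D0 hF Fp pq.
apply: ap_partition_residues => // i t iD it.
have [|P hP sP] := @ap_partition_changes (floor_diff F p) D (a + i) D t; first by rewrite D0 leqnn.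
exists P => //; apply: leq_trans sP _; rewrite leq_add2r.
case: t it {hP} => // t it; rewrite -pred_Sn.
pose b := (a + i)%N; rewrite -/b.
have itv m : (m <= t)%N -> (a <= b + D * m < a + n)%N.
  by move=> mt; have := it m mt; rewrite /b; lia.
pose qR : {poly R} := map_poly intr q.
(* The division is exact, since [D * m] divides the difference of the two values of [q]. Thus [I] is
   integer valued and, by [IE], is given by the real polynomial [r] of size at most [l.+1]. *)
pose I m := ((q.[Posz (b + D * m)] - q.[Posz b]) %/ Posz D)%Z.
pose r : {poly R} := D%:R^-1 *: (qR - (qR.[b%:R])%:P).
have DR : D%:R != 0 :> R by rewrite pnatr_eq0 -lt0n.
have sr : (size r <= l.+1)%N.
  apply: leq_trans (size_scale_leq _ _) _; apply: leq_trans (size_polyD _ _) _.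
  rewrite geq_max (leq_trans (size_poly _ _) sq) size_polyN.
  by apply: leq_trans (size_polyC_leq1 _) _.
have qE x : qR.[x%:R] = (q.[Posz x])%:~R by rewrite -map_poly_intr_int.
have IE m : (I m)%:~R = r.[b%:R + D%:R * m%:R].
  have dv : (Posz D %| q.[Posz (b + D * m)] - q.[Posz b])%Z.
    apply: dvdz_trans (dvdz_horner_sub _ _ _).
    by rewrite PoszD addrAC subrr add0r PoszM dvdz_mulr.
  rewrite /r hornerZ hornerD hornerN hornerC -natrM -natrD !qE.
  apply: (mulfI DR); rewrite mulVKf // -intrB -(divzK dv) intrM -/(I m) mulrC.
  by congr (_ * _).
pose Fm m := F (b + D * m)%N - (I m)%:~R.
pose Gm m := p.[(b + D * m)%:R] - (I m)%:~R.
have eE m : floor_diff F p (b + D * m) = Num.floor (Fm m) - Num.floor (Gm m).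
  rewrite /floor_diff /Fm /Gm -!intrN !floorDrz ?intr_int // !intrKfloor.
  by rewrite opprD addrACA subrr addr0.
rewrite (eq_changes (v := fun m => Num.floor (Fm m) - Num.floor (Gm m))); last by move=> m _; exact: eE.
pose c : R := qR.[b%:R] / D%:R.
have Gc m : (m <= t)%N -> `|Gm m - c| <= 1.
  move=> /itv /pq; congr (`|_| <= _); rewrite /Gm IE /r /c -/qR hornerZ hornerD hornerN hornerC.
  by rewrite natrD natrM; ring.
have FG m : (m <= t)%N -> `|Fm m - c| <= 2.
  move=> mt; have -> : Fm m - c = (F (b + D * m)%N - p.[(b + D * m)%:R]) + (Gm m - c).
    by rewrite /Fm /Gm; ring.
  apply: le_trans (ler_normD _ _) _; have := Gc m mt; have := Fp _ (itv m mt); lra.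
apply: leq_trans (changes_sub _ _ _) _.
have -> : (12 * l.+1 = 6 * l.+1 + 6 * l.+1)%N by lia.
apply: leq_add.
  apply: (@changes_floor _ _ c) => // u; apply: changes_level.
  (* Subtracting [r] does not affect differences of order [l.+1], so [Fm] keeps the sign condition
     of [F]. *)
  have E : iter l.+1 fdiff Fm =1 iter l.+1 fdiff (fun m => F (b + D * m)%N).
    move=> m; rewrite (@eq_iter_fdiff _ _ (fun m => F (b + D * m)%N - r.[b%:R + D%:R * m%:R])).
      by rewrite iter_fdiffB iter_fdiff_poly // subr0.
    by move=> j; rewrite /Fm IE.
  by case: (hF b D) => h; [left|right] => m; rewrite E.
apply: (@changes_floor _ _ c) => [m mt|u]; first by have := Gc m mt; lra.
apply: changes_level; left => m.
rewrite (@eq_iter_fdiff _ _ (fun m => (p - r).[b%:R + D%:R * m%:R])).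
  rewrite iter_fdiff_poly //; apply: leq_trans (size_polyD _ _) _.
  by rewrite geq_max sp size_polyN.
by move=> j; rewrite /Gm IE hornerD hornerN natrD natrM.
Qed.

(** Each window costs [(12 l + 1) M^(l^2)] pieces in either case: there are at most [M^(l^2)]
    residue classes in the dense case, and [M^(l^2)] blocks in the sparse one. *)
Lemma floor_diff_partition (R : archiRealFieldType) (l : nat) (F : nat -> R) (p : {poly R})
    (d : R) (H M : nat) :
  let W := (M ^ (l * l).+1)%N in
  (0 < l)%N -> (0 < M)%N -> (size p <= l)%N ->
  (forall b s, one_signed (iter l fdiff (fun m => F (b + s * m)%N))) ->
  (forall x, (x < H)%N -> `|F x - p.[x%:R]| <= d) -> d <= 1 ->
  l%:R * (d * W%:R ^+ l.-1) <= 1 ->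
  exists2 P, ap_partition (floor_diff F p) (M ^ (l * l)) (fun x => (x < H)%N) P
    & (size P <= (12 * l + 1) * M ^ (l * l) * (H %/ W).+1)%N.
Proof.
move=> W l0 M0 sp hF Fp d1 dW; set e := floor_diff F p.
have W0 : (0 < W)%N by rewrite expn_gt0 M0.
have [P hP sP] : exists2 P, ap_partition e (M ^ (l * l)) (fun x => `[< in_ap (0, 1, H)%N x >]) P
    & (size P <= (12 * l + 1) * M ^ (l * l) * (H %/ W).+1)%N; last first.
  by exists P => //; apply: eq_ap_partition hP => x; rewrite in_ap_interval add0n.
apply: (@ap_partition_blocks _ _ W); first by rewrite mulnC ltnW // -ltn_divLR.
move=> a n _ anH nW; rewrite add0n in anH.
have [[c [m [ac cm mM hs]]]|sparse] := pselect (exists c m,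
    [/\ (a <= c)%N, (c + m <= a + n)%N, (m <= M)%N & (l <= count (fun x => e x != 0) (iota c m))%N]).
  pose s := take l [seq x <- iota c m | e x != 0].
  have ss : size s = l by rewrite size_takel // size_filter.
  have sP x : x \in s -> e x != 0 /\ (c <= x < c + m)%N.
    by move=> /mem_take; rewrite mem_filter mem_iota => /andP[].
  have [||||D [q [D0 DM sq] hq]] := @interpolation R s c M p d W%:R.
  - by rewrite take_uniq // filter_uniq // iota_uniq.
  - by move=> x /sP[_]; lia.
  - by rewrite ss.
  - move=> x /sP[ex xc]; apply: (@floor_neq_near_int _ (F x)); first by apply: Fp; lia.
    by apply: contra ex => /eqP E; rewrite /e /floor_diff E subrr.
  rewrite ss in DM sq hq.
  have [||P hP sP2] := @floor_diff_residues R l F p D a n q l0 sp sq D0 hF.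
  - by move=> x xa; apply: le_trans d1; apply: Fp; lia.
  - move=> x xa; apply: le_trans dW; apply: hq => y /sP[_ yc].
    (* The interpolation points and [x] lie in the same window, of length at most [W]. *)
    have xyW : (x <= y + W)%N && (y <= x + W)%N by lia.
    move: xyW; rewrite -!(ler_nat R) !natrD => /andP[? ?].
    by rewrite ler_norml; apply/andP; split; lra.
  exists P; first exact: ap_partition_leq hP.
  by apply: leq_trans sP2 _; rewrite leq_mul2l DM orbT.
apply: (@ap_partition_blocks _ _ M); first by rewrite -expnS.
move=> c m ac cm mM.
have [|P hP sP] := @ap_partition_changes e (M ^ (l * l)) c 1 m; first by rewrite expn_gt0 M0.
exists P => //; apply: leq_trans sP _; rewrite leq_add2r.
case: m cm mM {hP} => // m cm mM; rewrite -pred_Sn.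
(* A block with fewer than [l] nonzero values has fewer than [2 l] changes; [12 l] is kept to match
   the dense case. *)
apply: leq_trans (changes_sparse _ 0 _) _.
have -> : count (fun j => e (c + 1 * j)%N != 0) (iota 0 m.+1) =
          count (fun x => e x != 0) (iota c m.+1).
  rewrite -[in RHS](addn0 c) iotaDl count_map; apply: eq_count => j /=.
  by rewrite mul1n.
rewrite leqNgt; apply/negP => h; apply: sparse; exists c, m.+1; split=> //.
by move: h; set K := count _ _; lia.
Qed.

(** * Taylor approximation at large [N] and choice of the block length *)

Lemma eN_floor_diff (R : realType) (f : R -> R) (l N h : nat) :
  eN f l N h = floor_diff (fun x => f (N%:R + x%:R)) (taylor (fun j => derive1n j f) l N%:R) h.
Proof.
rewrite /eN /floor_diff; congr (_ - Num.floor _).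
rewrite /taylor_poly /taylor horner_poly; apply: eq_bigr => j _.
by ring.
Qed.

Lemma floor_diff_le1 (R : archiRealFieldType) (F : nat -> R) (p : {poly R}) (x : nat) :
  `|F x - p.[x%:R]| <= 1 -> -1 <= floor_diff F p x <= 1.
Proof.
rewrite /floor_diff ler_norml => /andP[h1 h2].
have /andP[f1 f2] := floor_itv (F x); have /andP[p1 p2] := floor_itv p.[x%:R].
have a1 : (Num.floor (F x))%:~R < (Num.floor p.[x%:R] + 1 + 1)%:~R :> R.
  by move: p2; rewrite !intrD; lra.
have a2 : (Num.floor p.[x%:R])%:~R < (Num.floor (F x) + 1 + 1)%:~R :> R.
  by move: f2; rewrite !intrD; lra.
by move: a1 a2; rewrite !ltr_int; lia.
Qed.

Lemma hardy_taylor_approx (R : realType) (l k : nat) (f : R -> R) :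
  (k < l)%N -> in_hardy f ->
  (exists2 C : R, 0 < C & eventually_ge (fun t : R => `|f t| <= C * t ^+ k)) ->
  (forall (j : nat) (x : R), 1 <= x -> derivable (derive1n j f) x 1) ->
  exists2 C : R, 1 <= C & forall N : nat, C <= N%:R ->
    (forall b s, one_signed (iter l fdiff (fun m => f (N%:R + (b + s * m)%N%:R)))) /\
    forall (H : nat) (Y : R), 0 < Y -> C * (H%:R ^+ l * Y) <= N%:R ^+ (l - k) ->
      forall x, (x < H)%N ->
        `|f (N%:R + x%:R) - (taylor (fun j => derive1n j f) l N%:R).[x%:R]| <= (l%:R * Y)^-1.
Proof.
move=> kl hf bf sm; have l0 : (0 < l)%N by lia.
have [C [a [a1 hC sgn]]] := hardy_derivative_decay l hf sm bf.
have tG := derive1n_tower sm.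
have C0 : 0 <= C.
  have ak : 0 < a ^+ k by apply: exprn_gt0; lra.
  rewrite -(pmulr_lge0 _ ak); apply: le_trans (hC a (lexx _)).
  by rewrite mulr_ge0 // exprn_ge0 //; lra.
have lR : 1 <= l%:R :> R by rewrite ler1n.
(* One constant serves twice: at least [a] as a threshold for [N], and at least [l * C] to absorb
   the factor [l] in the target error. *)
exists (a + l%:R * C) => [|N aN].
  by have : 0 <= l%:R * C; [exact: mulr_ge0|lra].
have lC : 0 <= l%:R * C by exact: mulr_ge0.
have {}aN : a <= N%:R by lra.
have tGN : derivative_tower (fun j => derive1n j f) N%:R by move=> j x Nx; apply: tG; lra.
split=> [b s|H Y Y0 hN x xH].
  have tGa : derivative_tower (fun j => derive1n j f) a by move=> j x ax; apply: tG; lra.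
  have := @iter_fdiff_tower R l _ a (N%:R + b%:R) s%:R tGa _ _ sgn.
  have aNb : a <= N%:R + b%:R by have := ler0n R b; lra.
  move=> /(_ aNb (ler0n _ _)).
  have E : iter l fdiff (fun m => f (N%:R + (b + s * m)%N%:R)) =1
      iter l fdiff (fun i => f (N%:R + b%:R + s%:R * i%:R)).
    by apply: eq_iter_fdiff => m; rewrite natrD natrM addrA.
  by case=> h; [left|right] => m; rewrite E.
have N0 : 0 < N%:R :> R by lra.
have bnd t : N%:R <= t -> `|derive1n l f t| <= C / N%:R ^+ (l - k).
  move=> Nt; have t0 : 0 < t by lra.
  rewrite ler_pdivlMr ?exprn_gt0 //.
  have h := hC t ltac:(lra); move: h; rewrite -[in t ^+ l](subnK (ltnW kl)) exprD mulrA.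
  rewrite ler_pM2r ?exprn_gt0 // => h; apply: le_trans h.
  by rewrite ler_wpM2l // lerXn2r // nnegrE ltW.
apply: le_trans (taylor_bound tGN bnd (ler0n _ _)) _.
rewrite invfM ler_pdivlMr // -[leLHS]mulrA mulrAC ler_pdivrMr ?exprn_gt0 //.
rewrite -(ler_pM2l (x := l%:R)); last by lra.
rewrite [leRHS]mulrA divff ?mul1r; last by rewrite pnatr_eq0 -lt0n.
apply: le_trans hN.
have xl : x%:R ^+ l <= H%:R ^+ l :> R by rewrite lerXn2r ?nnegrE // ler_nat ltnW.
have Hl : 0 <= H%:R ^+ l * Y by rewrite mulr_ge0 ?exprn_ge0 // ltW.
apply: (@le_trans _ _ (l%:R * C * (H%:R ^+ l * Y))); last by rewrite ler_wpM2r //; lra.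
by rewrite -mulrA ler_wpM2l // ler_wpM2l // ler_wpM2r // ltW.
Qed.

Lemma nat_root (K H : nat) : (0 < K)%N -> (0 < H)%N ->
  exists2 M, (0 < M)%N & (M ^ K <= H < M.+1 ^ K)%N.
Proof.
move=> K0 H0.
have ex : exists M, (M ^ K <= H)%N by exists 1%N; rewrite exp1n.
have bd M : (M ^ K <= H)%N -> (M <= H)%N.
  apply: leq_trans; case: M => // M; rewrite -{1}(expn1 M.+1); exact: leq_pexp2l.
case: (ex_maxnP ex bd) => M MH max; exists M.
  by apply: max; rewrite exp1n.
by rewrite MH ltnNge; apply/negP => /max; rewrite ltnn.
Qed.

(** With [M] the integer part of the [K]-th root of [H], there are [O(H / M)] pieces. The lower
    bound on [K] keeps the steps [M^(l^2)] and the interpolation loss [W^(l-1)] below [Y], which is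
    at least the square root of [H]. *)
Lemma floor_diff_few_pieces (R : realType) (l K : nat) (F : nat -> R) (p : {poly R})
    (H : nat) (Y : R) :
  (0 < l)%N -> (2 * (l * l).+1 * l <= K)%N -> (0 < H)%N -> (size p <= l)%N ->
  1 <= Y -> H%:R <= Y ^+ 2 ->
  (forall b s, one_signed (iter l fdiff (fun m => F (b + s * m)%N))) ->
  (forall x, (x < H)%N -> `|F x - p.[x%:R]| <= (l%:R * Y)^-1) ->
  exists D P, [/\ (D <= H)%N, D%:R <= Y,
    ap_partition (floor_diff F p) D (fun x => (x < H)%N) P
    & (size P)%:R <= (4 * (12 * l + 1))%N%:R * H%:R `^ (1 - K%:R^-1) :> R].
Proof.
move=> l0 lK H0 sp Y1 HY hF Fp.
have K0 : (0 < K)%N by apply: leq_trans lK; rewrite !muln_gt0 l0.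
have [M M0 /andP[MH HM]] := nat_root K0 H0.
have MX n : (n <= K)%N -> (M ^ n <= H)%N.
  by move=> nK; apply: leq_trans MH; rewrite leq_pexp2l.
have MY n : (2 * n <= K)%N -> (M ^ n)%:R <= Y.
  move=> nK; rewrite -(ler_pXn2r (ltn0Sn 1)) ?nnegrE //; last by lra.
  by apply: le_trans HY; rewrite -natrX ler_nat -expnM mulnC MX.
have lR : 1 <= l%:R :> R by rewrite ler1n.
have lY : 1 <= l%:R * Y by rewrite -[leLHS]mulr1 ler_pM.
have [P hP sP] := @floor_diff_partition R l F p (l%:R * Y)^-1 H M l0 M0 sp hF Fp
  ltac:(rewrite invf_le1; lra) ltac:(rewrite invfM mulrA mulrA divff ?mul1r ?pnatr_eq0 -?lt0n //;
    rewrite mulrC ler_pdivrMr ?mul1r; [rewrite -natrX -expnM; apply: MY; nia|lra]).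
exists (M ^ (l * l))%N, P; split=> //.
- by apply: MX; nia.
- by apply: MY; nia.
have W0 : (0 < M ^ (l * l).+1)%N by rewrite expn_gt0 M0.
have WH : (M ^ (l * l).+1 <= H)%N by apply: MX; nia.
(* As [W <= H], rounding up the number of windows costs at most a factor 2; the other 2 pays for
   replacing [M] by [2 * M], which exceeds the [K]-th root of [H]. *)
have MP : (2 * M * size P <= 4 * (12 * l + 1) * H)%N.
  have q1 : (0 < H %/ M ^ (l * l).+1)%N by rewrite divn_gt0.
  have q2 := leq_divM H (M ^ (l * l).+1).
  apply: (@leq_trans (2 * M * ((12 * l + 1) * M ^ (l * l) * (2 * (H %/ M ^ (l * l).+1))))).
    by rewrite leq_mul2l (leq_trans sP) ?orbT // leq_mul2l; apply/orP; right; lia.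
  apply: (@leq_trans (4 * (12 * l + 1) * (H %/ M ^ (l * l).+1 * M ^ (l * l).+1))); last first.
    by rewrite leq_mul2l q2 orbT.
  by rewrite expnS; lia.
have HK : H%:R `^ K%:R^-1 <= (2 * M)%:R :> R.
  have KR : K%:R != 0 :> R by rewrite pnatr_eq0 -lt0n.
  have -> : (2 * M)%:R = ((2 * M)%:R ^+ K) `^ K%:R^-1 :> R.
    by rewrite -powR_mulrn // -powRrM divff // powRr1.
  rewrite ge0_ler_powR ?invr_ge0 ?nnegrE ?exprn_ge0 //.
  rewrite -natrX ler_nat ltnW //; apply: leq_trans HM _.
  by rewrite leq_exp2r //; lia.
have Hp : 0 < H%:R `^ K%:R^-1 :> R by rewrite powR_gt0 // ltr0n.
rewrite powRB ?pnatr_eq0 -?lt0n ?H0 ?implybT // powRr1 // mulrA ler_pdivlMr //.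
apply: (@le_trans _ _ ((size P)%:R * (2 * M)%:R)); first by rewrite ler_wpM2l.
by rewrite -!natrM ler_nat mulnC.
Qed.

(** * Counting the functions with few constant pieces *)

Lemma ap_partition_count (H p : nat) :
  exists2 L : seq (seq int), size L = ((H.+1 ^ 3 * 3) ^ p)%N &
    forall e D P, (D <= H)%N -> ap_partition e D (fun x => (x < H)%N) P -> (size P <= p)%N ->
      (forall x, (x < H)%N -> -1 <= e x <= 1) -> [seq e x | x <- iota 0 H] \in L.
Proof.
pose T := ('I_H.+1 * 'I_H.+1 * 'I_H.+1 * 'I_3)%type.
(* A letter is a start, step and length, each at most [H], with a value in {-1, 0, 1} shifted by
   one. A word of [p] letters determines the function. *)
pose val (c : T) : nat * nat * nat * int :=
  (val c.1.1.1, val c.1.1.2, val c.1.2, Posz (val c.2) - 1).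
pose code (c : nat * nat * nat * int) : T :=
  (inord c.1.1.1, inord c.1.1.2, inord c.1.2, inord `|(c.2 + 1)%R|).
exists [seq [seq ap_decode [seq val c | c <- tval t] x | x <- iota 0 H] | t : p.-tuple T].
  by rewrite size_map -cardE card_tuple !card_prod !card_ord !expnS expn0 muln1 !mulnA.
move=> e D P DH hP sP eb.
have [f fE dec] := ap_partition_decode hP.
pose c0 := val (ord0, ord0, ord0, ord0).
(* Padding to length exactly [p] by empty progressions. *)
pose s := [seq (ap, f ap) | ap <- P] ++ nseq (p - size P) c0.
have codeK c : c \in s -> val (code c) = c.
  rewrite mem_cat => /orP[/mapP[[[a d] n] apP ->]|/nseqP[-> _]].
    rewrite /val /code fE //=.
    have [/= d0 dD n0 _] := hP.2 _ apP.
    have inH x : in_ap (a, d, n) x -> (x < H)%N.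
      move=> xin; rewrite -(lt0b (x < H)%N) -hP.1 -has_count.
      by apply/hasP; exists (a, d, n) => //; apply/asboolP.
    have aH : (a < H)%N by apply: inH; exists 0%N; rewrite ?muln0 ?addn0.
    (* The last term bounds the length by [H]. It says nothing about the step of a one-term
       progression, which is bounded through [D <= H]. *)
    have nH : (a + d * n.-1 < H)%N by apply: inH; exists n.-1 => //; lia.
    have nd : (n.-1 <= d * n.-1)%N by rewrite leq_pmull.
    have ea := eb _ aH.
    rewrite !inordK; try lia.
    congr (_, _); lia.
  rewrite /c0 /val /code /= !inordK //=.
have ss : size [seq code c | c <- s] == p.
  by rewrite size_map size_cat size_map size_nseq subnKC.
apply/mapP; exists (Tuple ss); first by rewrite mem_enum.
apply/eq_in_map => x; rewrite mem_iota add0n => /andP[_ xH] /=.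
by rewrite -map_comp map_id_in // dec.
Qed.

(** Replaces [log H] by an arbitrarily small power of [H]: apply [x <= exp x] to the [j]-th root of
    [H] and raise to the power [j]. *)
Lemma powR_exp_bound (R : realType) (H j : nat) : (0 < H)%N -> (0 < j)%N ->
  H%:R <= expR (j%:R * H%:R `^ j%:R^-1) :> R.
Proof.
move=> H0 j0; have jR : j%:R != 0 :> R by rewrite pnatr_eq0 -lt0n.
have e : H%:R = (H%:R `^ j%:R^-1) ^+ j :> R.
  by rewrite -powR_mulrn ?powR_ge0 // -powRrM mulVf // powRr1.
rewrite {1}e expRM_natl lerXn2r ?nnegrE ?powR_ge0 ?expR_ge0 //.
by apply: le_trans (expR_ge1Dx _); rewrite lerDr.
Qed.

Lemma lerD_mul3 (R : realDomainType) (a b x y z : R) :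
  a <= y -> b <= z -> 2 <= x -> 1 <= y -> 1 <= z -> a + b <= x * y * z.
Proof.
move=> ay bz x2 y1 z1; apply: le_trans (lerD ay bz) _.
have yz : y + z <= 2 * (y * z) by nra.
by apply: le_trans yz _; rewrite -mulrA ler_wpM2r // mulr_ge0 //; lra.
Qed.

(** * Choice of the exponent and conclusion *)

Theorem theorem2p11 (R : realType) (l : nat) :
  exists eta : R, 0 < eta < 1 /\
  forall (k : nat) (f : R -> R),
    (k < l)%N ->
    in_hardy f ->
    (exists2 C : R, 0 < C & eventually_ge (fun t : R => `|f t| <= C * t ^+ k)) ->
    (forall (j : nat) (x : R), 1 <= x -> derivable (derive1n j f) x 1) ->
    exists2 C : R, 0 < C &
    forall H : nat,
      (* at most exp(O(H^eta)) distinct functions e_N on {0,...,H-1} *)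
      (exists L : seq (seq int),
          (size L)%:R <= expR (C * H%:R `^ eta) /\
          forall N : nat, (1 <= N)%N ->
            [seq eN f l N h | h <- iota 0 H] \in L) /\
      (* trichotomy (A) / (B) / (C) *)
      (forall N : nat, (1 <= N)%N ->
         [\/ N%:R <= C * H%:R `^ ((l%:R + eta) / (l%:R - k%:R)),
             (count (fun h => eN f l N h != 0) (iota 0 H))%:R <= C * H%:R `^ eta
           | exists P : seq (nat * nat * nat),
               [/\ (size P)%:R <= C * H%:R `^ eta,
                   (forall ap, ap \in P ->
                      [/\ (1 <= ap.1.2)%N, (1 <= ap.2)%N,
                          (ap.1.2)%:R <= C * H%:R `^ eta
                        & forall x, in_ap ap x -> (x < H)%N]),
                   (forall x, (x < H)%N ->
                      (count (fun ap => `[< in_ap ap x >]) P = 1)%N)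
                 & (forall ap x y, ap \in P -> in_ap ap x -> in_ap ap y ->
                      eN f l N x = eN f l N y)]]).
Proof.
pose K := (2 * (l * l).+1 * l + 2)%N.
have lK : (2 * (l * l).+1 * l <= K)%N by exact: leq_addr.
have K2 : (2 <= K)%N by exact: leq_addl.
have K0 : (0 < 2 * K)%N by rewrite muln_gt0 /= (ltnW K2).
move: K lK K2 K0 => K lK K2 K0.
have KR : 2 <= K%:R :> R by rewrite ler_nat.
have KV : K%:R * K%:R^-1 = 1 :> R by rewrite divff //; lra.
have KV0 : 0 < K%:R^-1 :> R by rewrite invr_gt0; lra.
have KV1 : K%:R^-1 <= 1 / 2 :> R.
  by have := ler_wpM2r (ltW KV0) KR; lra.
(* There are [O(H^(1-1/K))] pieces; the spare factor [H^(1/(2K))] up to [H^eta] absorbs the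
   logarithm of the number of letters. *)
set eta : R := 1 - (2 * K)%:R^-1.
have etaE : eta = 1 - K%:R^-1 / 2 by rewrite /eta natrM invfM mulrC.
exists eta; split; first by rewrite etaE; apply/andP; split; lra.
move=> k f kl hf bf sm.
have l0 : (0 < l)%N by lia.
have [C C1 approx] := hardy_taylor_approx kl hf bf sm.
pose c0 : R := (4 * (12 * l + 1))%:R.
(* The first 1 pays for adding the two counts, the next two terms for the small [N], and the last
   for the large ones. *)
pose C2 : R := 1 + C + (2 * K * l.+1)%:R + c0 * (24 + (2 * K * 3)%:R).
have c00 : 0 <= c0 by rewrite ler0n.
have h1 : 0 <= (2 * K * l.+1)%:R :> R by exact: ler0n.
have h24 : 0 <= 24 + (2 * K * 3)%:R :> R by apply: addr_ge0; exact: ler0n.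
have h2 : 0 <= c0 * (24 + (2 * K * 3)%:R) by exact: mulr_ge0.
have CC2 : C <= C2 by rewrite /C2; lra.
have cC2 : c0 <= C2.
  have h4 : c0 <= c0 * (24 + (2 * K * 3)%:R).
    have h3 : 0 <= (2 * K * 3)%:R :> R by [].
    by rewrite ler_peMr //; lra.
  by rewrite /C2; lra.
exists C2 => [|H]; first by lra.
(* For [H = 0] the power [H^eta] is 0: there is one empty function, and (B) holds. *)
have [->|H0] := posnP H.
  split; first by exists [:: [::]]; split=> //; rewrite powR0 ?mulr0 ?expR0 // etaE; lra.
  by move=> N _; apply: Or32; rewrite /= powR0 ?mulr0 // etaE; lra.
have HR : 1 <= H%:R :> R by rewrite ler1n.
set Y := H%:R `^ eta.
have Y1 : 1 <= Y by rewrite /Y -[leLHS](powRr0 H%:R) ler_powR // etaE; lra.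
have HY : H%:R <= Y ^+ 2.
  by rewrite /Y -powR_mulrn ?powR_ge0 // -powRrM -[leLHS]powRr1 // ler_powR // etaE; lra.
pose A : R := H%:R `^ ((l%:R + eta) / (l%:R - k%:R)).
have lkR : 1 <= l%:R - k%:R :> R by rewrite -natrB ?ler1n ?subn_gt0 // ltnW.
have struct N : C * A < N%:R ->
  exists D P, [/\ (D <= H)%N, D%:R <= Y,
    ap_partition (eN f l N) D (fun x => (x < H)%N) P
    & (size P)%:R <= c0 * H%:R `^ (1 - K%:R^-1)] /\
   forall x, (x < H)%N -> -1 <= eN f l N x <= 1.
  move=> CAN.
  have A1 : 1 <= A.
    rewrite /A -[leLHS](powRr0 H%:R) ler_powR // divr_ge0 //; last by lra.
    by rewrite etaE; have := ler0n R l; lra.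
  have CN : C <= N%:R.
    by apply: le_trans (ltW CAN); rewrite ler_peMr //; lra.
  have [one apx] := approx N CN.
  have {}apx : forall x, (x < H)%N ->
      `|f (N%:R + x%:R) - (taylor (fun j => derive1n j f) l N%:R).[x%:R]| <= (l%:R * Y)^-1.
    apply: apx; first by lra.
    (* The exponent in (A) is chosen for this identity, so its failure is the size condition on [N]
       in the Taylor approximation. *)
    have -> : H%:R ^+ l * Y = A ^+ (l - k).
      rewrite /Y /A -!powR_mulrn ?powR_ge0 // -powRrM natrB ?(ltnW kl) // divfK; last by lra.
      by rewrite -powRD // pnatr_eq0 -lt0n H0 implybT.
    apply: (@le_trans _ _ ((C * A) ^+ (l - k))).
      rewrite exprMn ler_wpM2r ?exprn_ge0 ?powR_ge0 //.
      by rewrite ler_eXnr // subn_gt0.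
    by rewrite lerXn2r ?nnegrE ?mulr_ge0 ?powR_ge0 // ?ltW //; lra.
  have eE : floor_diff (fun x => f (N%:R + x%:R)) (taylor (fun j => derive1n j f) l N%:R) = eN f l N.
    by apply/funext => x; rewrite eN_floor_diff.
  have [D [P hP]] := floor_diff_few_pieces l0 lK H0 (size_poly _ _) Y1 HY one apx.
  exists D, P; rewrite -eE; split=> // x xH.
  apply: floor_diff_le1; apply: le_trans (apx x xH) _.
  have lR : 1 <= l%:R :> R by rewrite ler1n.
  have lY : 1 <= l%:R * Y by rewrite -[leLHS]mulr1 ler_pM.
  by rewrite invf_le1; lra.
split; last first.
  move=> N _; have [NA|/struct[D [P [[DH DY [cP hP] sP] _]]]] := leP N%:R (C * A).
    by apply: Or31; apply: le_trans NA _; rewrite ler_wpM2r ?powR_ge0.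
  apply: Or33; exists P; split.
  - apply: le_trans sP _; apply: ler_pM; rewrite ?powR_ge0 //.
    by rewrite ler_powR // etaE; lra.
  - move=> ap apP; have [d0 dD n0 _] := hP ap apP; split=> //.
      apply: (@le_trans _ _ D%:R); first by rewrite ler_nat.
      by apply: le_trans DY _; rewrite ler_peMl //; lra.
    move=> x xin; rewrite -(lt0b (x < H)%N) -cP -has_count.
    by apply/hasP; exists ap => //; apply/asboolP.
  - by move=> x xH; rewrite cP xH.
  - by move=> ap x y apP; have [_ _ _] := hP ap apP; apply.
pose y : R := H%:R `^ (2 * K)%:R^-1.
have yK : H%:R <= expR ((2 * K)%:R * y) by exact: powR_exp_bound.
have y0 : 0 <= y by exact: powR_ge0.
have y1 : 1 <= y by rewrite /y -[leLHS](powRr0 H%:R) ler_powR // invr_ge0.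
have yY : y <= Y.
  by rewrite /y /Y ler_powR // etaE natrM invfM mulrC; lra.
have zY : H%:R `^ (1 - K%:R^-1) * y = Y.
  rewrite /y /Y -powRD; last by rewrite pnatr_eq0 -lt0n H0 implybT.
  by congr (_ `^ _); rewrite etaE natrM invfM; field; lra.
pose n1 := (Num.truncn (C * A)).+1.
pose p := Num.truncn (c0 * H%:R `^ (1 - K%:R^-1)).
have [L sL hL] := ap_partition_count H p.
(* Those [N] satisfying (A) are listed one by one; they are polynomially many in [H]. For the others
   the function is decoded from at most [p] pieces. *)
exists ([seq [seq eN f l N h | h <- iota 0 H] | N <- iota 0 n1] ++ L); split; last first.
  move=> N _; rewrite mem_cat; have [NA|/struct[D [P [[DH DY hP sP] eb]]]] := leP N%:R (C * A).
    apply/orP; left; apply/mapP; exists N => //; rewrite mem_iota add0n /n1 ltnS.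
    by rewrite truncn_ge_nat // mulr_ge0 ?powR_ge0 //; lra.
  apply/orP; right; apply: hL hP _ eb => //.
  by rewrite truncn_ge_nat // mulr_ge0 ?powR_ge0.
rewrite size_cat size_map size_iota natrD.
have KY n : H%:R ^+ n <= expR ((2 * K * n)%:R * y) :> R.
  by rewrite natrM mulrAC expRM_natr lerXn2r ?nnegrE ?expR_ge0.
have b1 : n1%:R <= expR ((C + (2 * K * l.+1)%:R) * Y).
  have Al : A <= H%:R ^+ l.+1.
    rewrite -powR_mulrn // ler_powR // ler_pdivrMr; last by lra.
    have : (l%:R + eta) * 1 <= l.+1%:R * (l%:R - k%:R).
      have l1 : l%:R + eta <= l.+1%:R by rewrite -[in leRHS]addn1 natrD etaE; lra.
      apply: ler_pM => //; rewrite etaE; have := ler0n R l; lra.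
    by rewrite mulr1.
  have H1 : 1 <= H%:R ^+ l.+1 :> R by exact: exprn_ege1.
  apply: (@le_trans _ _ ((1 + C) * H%:R ^+ l.+1)).
    have tr : (Num.truncn (C * A))%:R <= C * A by rewrite truncn_le // mulr_ge0 ?powR_ge0 //; lra.
    have CA : C * A <= C * H%:R ^+ l.+1 by rewrite ler_wpM2l //; lra.
    by rewrite /n1 -add1n natrD mulrDl mul1r lerD // (le_trans tr).
  rewrite [in leRHS]mulrDl expRD; apply: ler_pM.
  - lra.
  - exact: exprn_ge0 (ler0n _ _).
  - by apply: le_trans (expR_ge1Dx _) _; rewrite ler_expR; apply: ler_peMr; lra.
  - by apply: le_trans (KY _) _; rewrite ler_expR; exact: ler_wpM2l.
have b2 : (size L)%:R <= expR (c0 * (24 + (2 * K * 3)%:R) * Y).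
  have letters : (H.+1 ^ 3 * 3)%:R <= expR ((24 + (2 * K * 3)%:R) * y).
    (* Since [H >= 1], [3 (H+1)^3 <= 3 (2H)^3 = 24 H^3]. *)
    apply: (@le_trans _ _ (24 * H%:R ^+ 3)).
      rewrite -natrX -[24]/(24%:R) -natrM ler_nat.
      have : (H.+1 ^ 3 <= (2 * H) ^ 3)%N by rewrite leq_exp2r // mul2n -addnn -addn1 leq_add2l.
      rewrite expnMn => h; apply: leq_trans (leq_mul h (leqnn 3)) _.
      by rewrite mulnAC.
    rewrite [in leRHS]mulrDl expRD; apply: ler_pM (KY 3); [exact: ler0n| |].
      exact: exprn_ge0 (ler0n _ _).
    by apply: le_trans (expR_ge1Dx _); lra.
  rewrite sL natrX.
  apply: (@le_trans _ _ (expR ((24 + (2 * K * 3)%:R) * y) ^+ p)).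
    by rewrite lerXn2r ?nnegrE ?expR_ge0.
  rewrite -expRM_natl ler_expR -zY.
  have -> : c0 * (24 + (2 * K * 3)%:R) * (H%:R `^ (1 - K%:R^-1) * y) =
      c0 * H%:R `^ (1 - K%:R^-1) * ((24 + (2 * K * 3)%:R) * y) by ring.
  apply: ler_wpM2r; first exact: mulr_ge0.
  by rewrite /p truncn_le // mulr_ge0 ?powR_ge0.
have -> : C2 * Y = Y + (C + (2 * K * l.+1)%:R) * Y + c0 * (24 + (2 * K * 3)%:R) * Y.
  by rewrite /C2; ring.
rewrite !expRD.
have B1 : 1 <= expR ((C + (2 * K * l.+1)%:R) * Y).
  by rewrite -[leLHS]expR0 ler_expR; apply: mulr_ge0; lra.
have B2 : 1 <= expR (c0 * (24 + (2 * K * 3)%:R) * Y).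
  by rewrite -[leLHS]expR0 ler_expR; apply: mulr_ge0 h2 _; lra.
have Y2 : 2 <= expR Y by apply: le_trans (expR_ge1Dx _); lra.
exact: lerD_mul3 b1 b2 Y2 B1 B2.
Qed.
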